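(* Let $(\bar p,\bar x)\in\mathrm{graph}\,\mathcal{S}$, where $\mathcal{S}:\mathbb{P}\rightrightarrows\mathbb{X}$ is the solution mapping $\mathcal{S}(p)=\{x\in\mathbb{X}\ |\ F(p,x)\subseteq C\}$. If $F:\mathbb{P}\times\mathbb{X}\rightrightarrows\mathbb{Y}$ is $C$-concave on $\mathbb{P}\times\mathbb{X}$, then the graphical derivative $\mathrm{D}\mathcal{S}(\bar p,\bar x):\mathbb{P}\rightrightarrows\mathbb{X}$ is a closed sublinear set-valued mapping (a.k.a. convex process), i.e. its graph is a closed convex cone. If, in addition, $\mathrm{graph}\,\mathcal{S}$ is closed, then $\mathcal{S}$ is protodifferentiable at $(\bar p,\bar x)$.
   Context: Standing assumptions: $\mathbb{P}$ and $\mathbb{Y}$ are normed vector spaces, $\mathbb{X}$ is a Banach space, $\mathbb{P}\times\mathbb{X}$ carries the max-norm, $C\subset\mathbb{Y}$ is a closed convex cone with $\mathrm{int}\,C\ne\varnothing$, and $F$ has nonempty values everywhere. A set-valued mapping $\Phi:\mathbb{V}\rightrightarrows\mathbb{Y}$ between normed vector spaces is $C$-concave in $\mathbb{V}$ if $\Phi(tx_1+(1-t)x_2)\subseteq t\Phi(x_1)+(1-t)\Phi(x_2)+C$ for all $x_1,x_2\in\mathbb{V}$ and all $t\in[0,1]$ (here $\mathbb{V}=\mathbb{P}\times\mathbb{X}$). $\mathrm{graph}\,\mathcal{S}=\{(p,x)\ |\ x\in\mathcal{S}(p)\}$. The contingent cone to a set $S$ at $y\in S$ is $\mathrm{T}(S;y)=\{v\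 |\ \liminf_{t\downarrow0}\mathrm{dist}(y+tv,S)/t=0\}$. The graphical (contingent) derivative of $\mathcal{S}$ at $(\bar p,\bar x)\in\mathrm{graph}\,\mathcal{S}$ is the set-valued mapping $\mathrm{D}\mathcal{S}(\bar p,\bar x):\mathbb{P}\rightrightarrows\mathbb{X}$ with $\mathrm{graph}\,\mathrm{D}\mathcal{S}(\bar p,\bar x)=\mathrm{T}(\mathrm{graph}\,\mathcal{S};(\bar p,\bar x))$; equivalently, $v\in\mathrm{D}\mathcal{S}(\bar p,\bar x)(p)$ iff there are sequences $p_n\to p$, $v_n\to v$, $t_n\downarrow0$ ($t_n>0$) with $\bar x+t_nv_n\in\mathcal{S}(\bar p+t_np_n)$ for all $n\in\mathbb{N}$. $\mathcal{S}$ is protodifferentiable at $(\bar p,\bar x)$ if for every $p\in\mathbb{P}$, every $v\in\mathrm{D}\mathcal{S}(\bar p,\bar x)(p)$ and every choice of a sequence $(t_n)_n$ in $(0,+\infty)$ with $t_n\downarrow0$, there exist sequences $p_n\to p$ in $\mathbb{P}$ and $v_n\to v$ in $\mathbb{X}$ such that $\bar x+t_nv_n\in\mathcal{S}(\bar p+t_np_n)$ for all $n\in\mathbb{N}$. *)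

(* Defs.v *)
From HB Require Import structures.
From mathcomp Require Import all_boot all_order all_algebra.
From mathcomp Require Import all_classical all_reals all_analysis.

Set Implicit Arguments.
Unset Strict Implicit.
Unset Printing Implicit Defensive.

Import Order.TTheory GRing.Theory Num.Theory.
Import numFieldNormedType.Exports.

Local Open Scope classical_set_scope.
Local Open Scope ring_scope.

(* A set-valued mapping V => W is a function V -> set W. *)

Definition graph (V W : Type) (Phi : V -> set W) : set (V * W) :=
  [set z | Phi z.1 z.2].

Definition set_scale (R : realType) (W : normedModType R)
    (t : R) (A : set W) : set W :=
  [set t *: a | a in A].

Definition set_add (R : realType) (W : normedModType R)
    (A B : set W) : set W :=
  [set a + b | a in A & b in B].

(* Scaling by l = 0 is included, so a cone contains the origin. *)
Definition is_cone (R : realType) (V : normedModType R) (K : set V) : Prop :=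
  K !=set0 /\ forall (l : R) (x : V), 0 <= l -> K x -> K (l *: x).

Definition closed_convex_cone (R : realType) (V : normedModType R)
    (K : set V) : Prop :=
  [/\ closed K, convex_set K & is_cone K].

Definition cone_concave (R : realType) (V W : normedModType R)
    (C : set W) (Phi : V -> set W) : Prop :=
  forall (x1 x2 : V) (t : R), 0 <= t <= 1 ->
    Phi (t *: x1 + (1 - t) *: x2) `<=`
      set_add (set_add (set_scale t (Phi x1)) (set_scale (1 - t) (Phi x2))) C.

Definition solution_map (R : realType) (P X Y : normedModType R)
    (F : P * X -> set Y) (C : set Y) : P -> set X :=
  fun p => [set x | F (p, x) `<=` C].

(* liminf_{t -> 0+} dist(y + t v, S) / t = 0; the distance to S is
   extended-real valued (+oo when S is empty). *)
Definition contingent_cone (R : realType) (V : normedModType R)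
    (S : set V) (y : V) : set V :=
  [set v : V | limf_einf (fun t : R => (edist_inf S (y + t *: v)%R * (t^-1)%:E)%E)
             (0 : R)^'+ = 0%E].

Definition graphical_derivative (R : realType) (P X : normedModType R)
    (S : P -> set X) (pbar : P) (xbar : X) : P -> set X :=
  fun p => [set v | contingent_cone (graph S) (pbar, xbar) (p, v)].

Definition closed_sublinear (R : realType) (P X : normedModType R)
    (Phi : P -> set X) : Prop :=
  closed_convex_cone (graph Phi).

Definition protodifferentiable (R : realType) (P X : normedModType R)
    (S : P -> set X) (pbar : P) (xbar : X) : Prop :=
  forall (p : P) (v : X), graphical_derivative S pbar xbar p v ->
  forall t_ : nat -> R, (forall n, 0 < t_ n) -> t_ @ \oo --> (0 : R) ->
  exists (p_ : nat -> P) (v_ : nat -> X),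
    [/\ p_ @ \oo --> p, v_ @ \oo --> v &
        forall n, S (pbar + t_ n *: p_ n) (xbar + t_ n *: v_ n)].

(* Main.v *)
Require Import Defs.
From HB Require Import structures.
From mathcomp Require Import all_boot all_order all_algebra.
From mathcomp Require Import all_classical all_reals all_analysis.

Set Implicit Arguments.
Unset Strict Implicit.
Unset Printing Implicit Defensive.

Import Order.TTheory GRing.Theory Num.Theory.
Import numFieldNormedType.Exports.

Local Open Scope classical_set_scope.
Local Open Scope ring_scope.

(** The graph G of the solution mapping is convex: for x and y in G, the values
    of F at t x + (1 - t) y lie in t C + (1 - t) C + C, hence in C. Everything
    else holds for an arbitrary convex subset G of a normed space and a point z
    of G.

    Convexity makes G star-shaped about z: if z + t w is in G, then so is
    z + s w whenever 0 <= s <= t [convex_segment]. Hence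
    dist (z + s v, G) / s is small for all small s > 0 as soon as v is close to
    a direction w along which a single step from z stays in G. This identifies
    the contingent cone with the closure of the set of feasible directions
    [convex_contingent_coneE]. Feasible directions form a convex cone, and the
    closure of a convex cone is a closed convex cone; this is the first claim.

    For protodifferentiability the step sizes t_n are given, and w_n is taken
    to be a near-minimiser of |v - w| among all w with z + t_n w in G. A
    feasible direction close to v competes in this minimisation as soon as t_n
    is small enough, again because G is star-shaped, so w_n tends to v
    [recovery_directions]. *)

(** Real weights in place of the bundled unit-interval weights and boolean
    membership of [convex_set]. *)
Lemma convex_setP (R : realType) (V : normedModType R) (A : set V) :
  convex_set A <-> forall (x y : V) (t : R), 0 <= t <= 1 -> A x -> A y ->
    A (t *: x + (1 - t) *: y).
Proof.
split=> [cA x y t /andP[t0 t1] Ax Ay|cA].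
  have := cA x y (Itv01 t0 t1); rewrite !inE => /(_ Ax Ay).
  by rewrite /conv/=.
move=> x y l; rewrite !inE => Ax Ay.
apply: cA => //.
by apply/andP; split.
Qed.

Lemma closure_normP (R : realType) (V : normedModType R) (A : set V) (v : V) :
  closure A v <-> forall e : R, 0 < e -> exists2 w, A w & `|v - w| < e.
Proof.
split=> [cl e e0|h B].
  have [w [Aw]] := cl _ (nbhsx_ballx v e e0).
  by rewrite -ball_normE /= => ?; exists w.
rewrite -nbhs_ballE => -[e /= e0 eB].
have [w Aw vw] := h e e0.
by exists w; split => //; apply: eB; rewrite -ball_normE.
Qed.

Definition feasible_directions (R : realType) (V : normedModType R)
    (G : set V) (z : V) : set V :=
  [set w | exists2 t : R, 0 < t & G (z + t *: w)].

Lemma convex_segment (R : realType) (V : normedModType R) (G : set V)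
    (z w : V) (s t : R) : convex_set G -> G z ->
  0 <= s -> s <= t -> G (z + t *: w) -> G (z + s *: w).
Proof.
move=> /convex_setP cG Gz s0 st Gw.
have [t0|t0] := leP t 0.
  by have -> : s = t by apply/le_anti; rewrite st (le_trans t0).
have -> : z + s *: w = (s / t) *: (z + t *: w) + (1 - s / t) *: z.
  rewrite scalerDr scalerA divfK ?gt_eqF// addrAC -scalerDl addrCA subrr addr0.
  by rewrite scale1r.
by apply: cG => //; rewrite divr_ge0 ?(ltW t0)//= ler_pdivrMr// mul1r.
Qed.

(** If the lower limit vanishes, some quotient dist (z + t v, G) / t is below e;
    a point a of G realising this bound gives the direction (a - z) / t, at
    distance less than e from v. *)
Lemma contingent_cone_sub_closure (R : realType) (V : normedModType R)
    (G : set V) (z : V) :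
  contingent_cone G z `<=` closure (feasible_directions G z).
Proof.
move=> v; rewrite /contingent_cone /= limf_einfE => Tv.
apply/closure_normP => e e0.
set q := (fun t : R => _) in Tv.
have : (ereal_inf (q @` [set t : R | (0 < t)%R]) <= 0)%E.
  rewrite -Tv; apply: ereal_sup_ubound; exists [set t : R | 0 < t] => //.
  exact: nbhs_right_gt.
move=> /le_lt_trans/(_ (_ : 0 < e%:E)%E); rewrite lte_fin => /(_ e0).
move=> /ereal_inf_lt[_ [t /= t0 <-]].
rewrite /q lte_pdivrMr// -EFinM => /ereal_inf_lt[_ [a Ga <-]].
move=> /edist_lt_ball/=; rewrite -ball_normE/= => h.
exists (t^-1 *: (a - z)).
  by exists t => //; rewrite scalerA divff ?gt_eqF// scale1r addrC subrK.
have -> : v - t^-1 *: (a - z) = t^-1 *: (z + t *: v - a).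
  by rewrite addrAC [RHS]scalerDr scalerA mulVf ?gt_eqF// scale1r [RHS]addrC
    -scalerN opprB.
by rewrite normrZ gtr0_norm ?invr_gt0// mulrC ltr_pdivrMr.
Qed.

(** A feasible direction w with |v - w| < e bounds the quotient by e at every
    small step s, since z + s w is still in G. So the quotient even converges
    to 0, which is more than the lower limit asks for. *)
Lemma closure_sub_contingent_cone (R : realType) (V : normedModType R)
    (G : set V) (z : V) : convex_set G -> G z ->
  closure (feasible_directions G z) `<=` contingent_cone G z.
Proof.
move=> cG Gz v /closure_normP clv; rewrite /contingent_cone /= limf_einfE.
set q := (fun t : R => _).
apply/eqP; rewrite eq_le; apply/andP; split; last first.
  apply: le_trans (_ : (ereal_inf (q @` [set t : R | (0 < t)%R]) <= _)%E);
    last first.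
    apply: ereal_sup_ubound; exists [set t : R | 0 < t] => //.
    exact: nbhs_right_gt.
  apply: le_ereal_inf_tmp => _ [t /= t0 <-].
  by rewrite /q mule_ge0 ?edist_inf_ge0 ?lee_fin ?invr_ge0 ?ltW.
apply: ge_ereal_sup => _ [U U0 <-].
apply/lee_addgt0Pr => e e0; rewrite add0e.
have [w [t t0 Gw] vw] := clv e e0.
have [s [Us s0 st]] : exists s, [/\ U s, 0 < s & s <= t].
  have /filter_ex : \forall s \near (0:R)^'+, U s /\ 0 < s <= t.
    near=> s; split; first by near: s.
    by apply/andP; split; near: s; [exact: nbhs_right_gt|exact: nbhs_right_le].
  by move=> [s [Us /andP[? ?]]]; exists s.
apply: le_trans (_ : (q s <= _)%E).
  by apply: ereal_inf_lbound; exists s.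
rewrite /q lee_pdivrMr// -EFinM.
apply: le_trans (_ : (edist (z + s *: v, z + s *: w)%R <= _)%E).
  apply: ereal_inf_lbound; exists (z + s *: w) => //.
  exact: (convex_segment cG Gz (ltW s0) st).
apply: edist_fin; first by rewrite mulr_gt0.
rewrite -ball_normE /= opprD addrACA subrr add0r -scalerBr normrZ gtr0_norm//.
by rewrite mulrC ltr_pM2r.
Unshelve. all: by end_near. Qed.

Lemma convex_contingent_coneE (R : realType) (V : normedModType R)
    (G : set V) (z : V) : convex_set G -> G z ->
  contingent_cone G z = closure (feasible_directions G z).
Proof.
move=> cG Gz; apply/seteqP; split; first exact: contingent_cone_sub_closure.
exact: closure_sub_contingent_cone.
Qed.

Lemma feasible_directions_convex_cone (R : realType) (V : normedModType R)
    (G : set V) (z : V) : convex_set G -> G z ->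
  convex_set (feasible_directions G z) /\ is_cone (feasible_directions G z).
Proof.
move=> cG Gz; split.
  apply/convex_setP => x y l l01 [s s0 Gx] [t t0 Gy].
  (* At the smaller of the two step sizes both directions are feasible. *)
  exists (Num.min s t); first by rewrite lt_min s0.
  set m := Num.min s t.
  have m0 : 0 <= m by rewrite le_min !ltW.
  have -> : z + m *: (l *: x + (1 - l) *: y) =
            l *: (z + m *: x) + (1 - l) *: (z + m *: y).
    rewrite !scalerDr addrACA -scalerDl [l + _]addrC subrK scale1r !scalerA.
    by rewrite ![m * _]mulrC.
  apply: (convex_setP G).1 => //; [move: Gx|move: Gy];
    by apply: convex_segment => //; rewrite ge_min lexx ?orbT.
have K0 : feasible_directions G z 0.
  by exists 1 => //; rewrite scaler0 addr0.
split; first by exists 0.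
move=> l x; rewrite le_eqVlt => /predU1P[<- _|l0 [t t0 Gx]].
  by rewrite scale0r.
exists (t / l); first by rewrite divr_gt0.
by rewrite scalerA divfK ?gt_eqF.
Qed.

Lemma closure_convex_cone (R : realType) (V : normedModType R) (A : set V) :
  convex_set A -> is_cone A -> closed_convex_cone (closure A).
Proof.
move=> /convex_setP cA [[a Aa] Acone]; split; first exact: closed_closure.
  apply/convex_setP => x y t /andP[t0 t1] /closure_normP clx /closure_normP cly.
  apply/closure_normP => e e0.
  have [u Au xu] := clx e e0; have [w Aw yw] := cly e e0.
  exists (t *: u + (1 - t) *: w); first by apply: cA => //; rewrite t0.
  rewrite opprD addrACA -!scalerBr.
  rewrite (le_lt_trans (ler_normD _ _))// !normrZ (ger0_norm t0).
  rewrite (@ger0_norm _ (1 - t)) ?subr_ge0//.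
  have [->|tn0] := eqVneq t 0.
    by rewrite mul0r add0r subr0 mul1r.
  have tp : 0 < t by rewrite lt_def tn0.
  have -> : e = t * e + (1 - t) * e by rewrite -mulrDl [t + _]addrC subrK mul1r.
  by rewrite ltr_leD ?ltr_pM2l// ler_wpM2l ?subr_ge0// ltW.
split; first by exists a; exact: subset_closure.
(* For l = 0 no estimate is available, but the origin is already in A. *)
move=> l x; rewrite le_eqVlt => /predU1P[<- _|l0 /closure_normP clx].
  by rewrite scale0r; apply: subset_closure; rewrite -(scale0r a); exact: Acone.
apply/closure_normP => e e0; have [u Au xu] := clx (e / l) (divr_gt0 e0 l0).
exists (l *: u); first by apply: Acone => //; exact: ltW.
by rewrite -scalerBr normrZ gtr0_norm// mulrC -ltr_pdivlMr.
Qed.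

(** The directions w_n are near-minimisers, within 1/(n+1), of the distance to v
    among those feasible at exactly the step t_n. Since w = 0 always competes,
    such a w_n exists even for the finitely many n with t_n large. A direction
    w close to v that is feasible at some step t is feasible at every t_n <= t,
    so it competes for all large n and forces w_n towards v. *)
Lemma recovery_directions (R : realType) (V : normedModType R)
    (G : set V) (z v : V) (t_ : nat -> R) : convex_set G -> G z ->
  closure (feasible_directions G z) v ->
  (forall n, 0 < t_ n) -> t_ @ \oo --> (0 : R) ->
  exists w_ : nat -> V, w_ @ \oo --> v /\ forall n, G (z + t_ n *: w_ n).
Proof.
move=> cG Gz /closure_normP clv t_gt0 t_cvg.
pose D n := [set `|v - w| | w in [set w | G (z + t_ n *: w)]].
have Dinf n : has_inf (D n).
  split; last by exists 0 => _ [w _ <-].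
  by exists `|v - 0|; exists 0 => //=; rewrite scaler0 addr0.
have /choice[w_ w_P] n : exists w, G (z + t_ n *: w) /\
    `|v - w| < inf (D n) + n.+1%:R^-1.
  have n1_gt0 : 0 < n.+1%:R^-1 :> R by [].
  have [_ [w Gw <-] h] := inf_adherent n1_gt0 (Dinf n).
  by exists w.
exists w_; split; last by move=> n; have [] := w_P n.
apply/cvgrPdist_lt => e e0.
have e20 : 0 < e / 2 by rewrite divr_gt0.
have [w [t t0 Gw] vw] := clv _ e20.
near=> n.
have [_ /lt_le_trans] := w_P n; apply.
rewrite (splitr e) lerD//; last first.
  near: n; have := near_infty_natSinv_lt (PosNum e20).
  by apply: filterS => n /ltW.
apply: le_trans (ltW vw); apply: ge_inf; first by have [] := Dinf n.
exists w => //=; apply: (convex_segment cG Gz _ _ Gw); first exact: ltW.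
near: n.
have /cvgrPdist_le/(_ _ t0) := t_cvg; apply: filterS => n.
by rewrite sub0r normrN gtr0_norm.
Unshelve. all: by end_near. Qed.

(** Concavity puts F (t x + (1 - t) y) in C + C + C, and a convex cone is closed
    under addition: a + b is twice the midpoint of a and b. *)
Lemma solution_graph_convex (R : realType) (P X Y : normedModType R)
    (C : set Y) (F : P * X -> set Y) :
  convex_set C -> is_cone C -> cone_concave C F ->
  convex_set (graph (solution_map F C)).
Proof.
move=> /convex_setP cC [_ kC] hconc.
have addC a b : C a -> C b -> C (a + b).
  move=> Ca Cb.
  have h : 0 <= (2^-1 : R) <= 1.
    by apply/andP; split; rewrite ?invr_ge0 ?ler0n// invf_le1// ler1n.
  have := kC 2 _ (ler0n _ _) (cC _ _ _ h Ca Cb).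
  have -> : 1 - 2^-1 = 2^-1 :> R by rewrite [X in X - _](splitr 1) div1r addrK.
  by rewrite scalerDr !scalerA divff ?pnatr_eq0// !scale1r.
apply/convex_setP => -[p x] [p' x'] t t01 Sx Sx' y.
rewrite -surjective_pairing => /(hconc _ _ _ t01).
move=> [_ [_ [a Fa <-] [_ [b Fb <-] <-]] [c Cc <-]].
have /andP[t0 t1] := t01.
apply: (addC _ _ _ Cc); apply: addC; apply: kC; rewrite ?subr_ge0//.
  exact: Sx.
exact: Sx'.
Qed.

Theorem corollary4p7 (R : realType) (P Y : normedModType R)
    (X : completeNormedModType R) (C : set Y) (F : P * X -> set Y)
    (hC : closed_convex_cone C) (hCint : C° !=set0)
    (hF : forall z : P * X, F z !=set0)
    (pbar : P) (xbar : X)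
    (hbar : graph (solution_map F C) (pbar, xbar))
    (hconc : cone_concave C F) :
  closed_sublinear (graphical_derivative (solution_map F C) pbar xbar) /\
  (closed (graph (solution_map F C)) ->
   protodifferentiable (solution_map F C) pbar xbar).
Proof.
have [_ cC kC] := hC.
have cG := solution_graph_convex cC kC hconc.
have TE := convex_contingent_coneE cG hbar.
split=> [|_ p v Dpv t_ t_gt0 t_cvg].
  rewrite /closed_sublinear.
  have -> : graph (graphical_derivative (solution_map F C) pbar xbar) =
            contingent_cone (graph (solution_map F C)) (pbar, xbar).
    by apply/funext => -[].
  rewrite TE.
  have [cK kK] := feasible_directions_convex_cone cG hbar.
  exact: closure_convex_cone cK kK.
move: Dpv; rewrite /graphical_derivative /= TE.
move=> /(recovery_directions cG hbar)/(_ t_gt0 t_cvg)[w_ [w_cvg Sw]].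
exists (fun n => (w_ n).1), (fun n => (w_ n).2); split => //.
- exact: (cvg_comp _ _ w_cvg (@cvg_fst _ _ _ _ _)).
- exact: (cvg_comp _ _ w_cvg (@cvg_snd _ _ _ _ _)).
Qed.
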